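(* Let $G$ be a star-shaped graph with at least two vertices, let $G_v=B_0\sqcup B_1\sqcup\dots\sqcup B_s$ be its decomposition into branches, with $B_0=\{g_0\}$, and let $|B_i|=n_i$, $i=1,\dots,s$. Put $r=(\mathrm{ind}(G))^2$. Then $$\rho_r(n_1,\dots,n_s)=r,$$ that is, $\sum_{i=1}^s\rho_r(n_i)=r$.
   Context: Graphs are finite, connected, without loops and multiple edges. $\mathrm{ind}(G)$ is the largest eigenvalue of the adjacency matrix of $G$; for a connected graph with at least two vertices $\mathrm{ind}(G)\ge1$. A point of branching is a vertex with at least $3$ neighbours. A star-shaped graph is a tree with at most one point of branching. Its vertex set $G_v$ is decomposed as $B_0\sqcup B_1\sqcup\dots\sqcup B_s$, where $B_0=\{g_0\}$, $g_0$ being the point of branching if it exists (and otherwise an arbitrary chosen vertex), and $B_1,\dots,B_s$ (the branches) are the nonempty classes of vertices other than $g_0$ such that two vertices $g,h$ lie in the same class iff the shortest path from $g$ to $h$ does not contain $g_0$ (i.e. the vertex sets of the connected components of $G\setminus\{g_0\}$). For real $r\ge1$ the function $\rho_r$ on nonnegative integers, with values in $\mathbb{R}\cup\{\infty\}$, is defined by $\rho_r(0)=0$, $\rho_r(n+1)=\dfrac{r}{r-\rho_r(n)}$, with the conventions that $\rho_r(n+1)=\infty$ if $\rho_r(n)=r$, and $\rho_r(n+1)=0$ if $\rho_r(n)=\infty$. For a tuple, $\rho_r(n_1,\dots,n_s)=\sum_{i=1}^s\rho_r(n_i)$. *)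

(* Defs.v *)
From HB Require Import structures.
From mathcomp Require Import all_boot all_order all_algebra.
From mathcomp Require Import all_classical all_reals.

Set Implicit Arguments.
Unset Strict Implicit.
Unset Printing Implicit Defensive.

Import Order.TTheory GRing.Theory Num.Theory.
Local Open Scope ring_scope.

Definition simple_graph (T : finType) (e : rel T) : Prop :=
  symmetric e /\ irreflexive e.

Definition connected_graph (T : finType) (e : rel T) : Prop :=
  forall x y : T, connect e x y.

(* A [ucycle] of size 2 only runs back and forth along an edge. *)
Definition acyclic (T : finType) (e : rel T) : Prop :=
  forall c : seq T, (2 < size c)%N -> ~ ucycle e c.

Definition tree (T : finType) (e : rel T) : Prop :=
  [/\ simple_graph e, connected_graph e & acyclic e].

Definition branching (T : finType) (e : rel T) (x : T) : Prop :=
  (3 <= #|[set y | e x y]|)%N.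

Definition star_shaped (T : finType) (e : rel T) : Prop :=
  tree e /\ (forall x y : T, branching e x -> branching e y -> x = y).

(* The branching point if there is one, and any vertex otherwise. *)
Definition center (T : finType) (e : rel T) (g0 : T) : Prop :=
  forall x : T, branching e x -> x = g0.

(* The vertices of the path are [x :: p]. *)
Definition shortest_path (T : finType) (e : rel T) (x y : T) (p : seq T) :
    Prop :=
  [/\ path e x p, last x p = y &
      forall q : seq T, path e x q -> last x q = y -> (size p <= size q)%N].

(* Shortest paths are unique in a tree. *)
Definition same_branch (T : finType) (e : rel T) (g0 : T) : rel T :=
  fun g h => `[< exists2 p : seq T, shortest_path e g h p & g0 \notin g :: p >].

Definition branches (T : finType) (e : rel T) (g0 : T) : {set {set T}} :=
  equivalence_partition (same_branch e g0) [set~ g0].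

(* [B] lists the branches without repetition. *)
Definition branch_decomposition (T : finType) (e : rel T) (g0 : T) (s : nat)
    (B : 'I_s -> {set T}) : Prop :=
  injective B /\ [set B i | i : 'I_s] = branches e g0.

Definition adjmx (R : realType) (T : finType) (e : rel T) : 'M[R]_#|T| :=
  \matrix_(i < #|T|, j < #|T|) (e (enum_val i) (enum_val j))%:R.

Definition largest_eigenvalue (R : realType) (n : nat) (A : 'M[R]_n) (a : R) :
    Prop :=
  eigenvalue A a /\ (forall b : R, eigenvalue A b -> b <= a).

(* The default 0 is never used: the real symmetric matrix [adjmx R e] has a
   largest eigenvalue as soon as the graph has a vertex. *)
Definition ind (R : realType) (T : finType) (e : rel T) : R :=
  xget 0 [set a : R | largest_eigenvalue (adjmx R e) a]%classic.

(* The single infinity of the codomain is represented by +oo; the value -oo is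
   never reached, so the branch for it is irrelevant. *)
Fixpoint rho (R : realType) (r : R) (n : nat) : \bar R :=
  if n is m.+1 then
    match rho r m with
    | EFin x => if x == r then +oo%E else (r / (r - x))%:E
    | +oo%E | -oo%E => 0%E
    end
  else 0%E.

Definition rho_tuple (R : realType) (r : R) (s : nat) (n : 'I_s -> nat) :
    \bar R :=
  (\sum_(i < s) rho r (n i))%E.

(* Main.v *)
(* Let [a] be the largest eigenvalue and [x] a positive eigenfunction for it
   (Perron-Frobenius).  Along a branch with vertices w_1, ..., w_n, counted from
   the leaf and followed by w_(n+1) = g0, the eigenvalue equation makes the
   ratios a x(w_k) / x(w_(k+1)) satisfy the recurrence defining rho at r = a^2,
   so that rho(n) = a x(w_n) / x(g0).  The eigenvalue equation at g0 says that
   these ratios add up to a^2. *)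
Require Import Defs.
From mathcomp Require Import all_boot all_order all_algebra.
From mathcomp Require Import all_classical all_reals.
From mathcomp Require Import ring lra.

Set Implicit Arguments.
Unset Strict Implicit.
Unset Printing Implicit Defensive.

Import Order.TTheory GRing.Theory Num.Theory.

Local Open Scope ring_scope.

(** * Quadratic forms and extremal eigenvalues of symmetric matrices *)

Definition qform (R : realType) n (A : 'M[R]_n) (u v : 'rV[R]_n) : R :=
  (u *m A *m v^T) 0 0.

Lemma qformE (R : realType) n (A : 'M[R]_n) (u v : 'rV[R]_n) :
  qform A u v = \sum_i \sum_j u 0 i * A i j * v 0 j.
Proof.
rewrite /qform mxE exchange_big /=; apply: eq_bigr => j _.
by rewrite !mxE mulr_suml.
Qed.

Lemma qform1E (R : realType) n (u : 'rV[R]_n) :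
  qform 1%:M u u = \sum_i u 0 i ^+ 2.
Proof.
by rewrite /qform mulmx1 mxE; apply: eq_bigr => i _; rewrite mxE expr2.
Qed.

Lemma qform1_ge0 (R : realType) n (u : 'rV[R]_n) : 0 <= qform 1%:M u u.
Proof. by rewrite qform1E sumr_ge0 // => i _; exact: sqr_ge0. Qed.

Lemma qform1_gt0 (R : realType) n (u : 'rV[R]_n) :
  u != 0 -> 0 < qform 1%:M u u.
Proof.
move=> u0; rewrite lt_def qform1_ge0 andbT; apply: contra u0 => /eqP.
rewrite qform1E => /psumr_eq0P z; apply/eqP/rowP => i; rewrite mxE.
by apply/eqP; rewrite -sqrf_eq0 z // => j _; exact: sqr_ge0.
Qed.

(** Each product of two coordinates is at most the squared norm [qform 1%:M u u] in absolute value.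
    The summand 1 in the witness makes the constant invertible. *)
Lemma qform_bounded (R : realType) n (A : 'M[R]_n) :
  exists2 C, 0 < C & forall u, qform A u u <= C * qform 1%:M u u.
Proof.
exists (1 + \sum_i \sum_j `|A i j|) => [|u].
  by rewrite ltr_pwDl // sumr_ge0 // => i _; rewrite sumr_ge0.
rewrite mulrDl mul1r; apply: ler_wpDl; first exact: qform1_ge0.
rewrite qformE mulr_suml; apply: ler_sum => i _.
rewrite mulr_suml; apply: ler_sum => j _.
have le_sqr k : u 0 k ^+ 2 <= qform 1%:M u u.
  rewrite qform1E (bigD1 k) //= lerDl sumr_ge0 // => l _; exact: sqr_ge0.
apply: le_trans (ler_norm _) _; rewrite !normrM mulrAC mulrC.
apply: ler_wpM2l => //; rewrite -normrM.
by have := le_sqr i; have := le_sqr j; case: ler0P => _; nra.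
Qed.

Lemma discriminant_le0 (R : realType) (a b c : R) :
  0 <= c -> (forall t, 0 <= a + 2 * t * b + t ^+ 2 * c) -> b ^+ 2 <= a * c.
Proof.
rewrite le_eqVlt => /predU1P[<-|c0] h.
  rewrite mulr0; have [->|b0] := eqVneq b 0; first by rewrite expr0n.
  (* If [c] is 0 and [b] is not, this [t] gives the affine function the value -1. *)
  have := h (- (a + 1) / (2 * b)); set t := _ / _.
  have -> : 2 * t * b = - (a + 1) by rewrite /t; field.
  by rewrite mulr0; lra.
(* The minimum of the quadratic polynomial is at this point. *)
have := h (- b / c).
have -> : a + 2 * (- b / c) * b + (- b / c) ^+ 2 * c = (a * c - b ^+ 2) / c.
  by field; rewrite gt_eqF.
by rewrite pmulr_lge0 ?invr_gt0 // subr_ge0.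
Qed.

(** The polynomial t -> A(u + t v) is nonnegative, so its discriminant is not positive; symmetry
    merges the two cross terms. *)
Lemma qform_Cauchy_Schwarz (R : realType) n (A : 'M[R]_n) :
  A^T = A -> (forall u, 0 <= qform A u u) ->
  forall u v, qform A u v ^+ 2 <= qform A u u * qform A v v.
Proof.
move=> symA psdA u v; apply: discriminant_le0 => // t.
have qC : qform A v u = qform A u v.
  by rewrite /qform -[v *m A *m u^T]trmxK mxE !trmx_mul trmxK symA mulmxA.
have := psdA (u + t *: v); congr (_ <= _).
have -> : 2 * t * qform A u v = t * qform A u v + t * qform A v u.
  by rewrite qC; ring.
rewrite /qform linearD linearZ /= !mulmxDl !mulmxDr -!scalemxAl -!scalemxAr.
set uu := u *m _ *m _; set uv := u *m _ *m _.
set vu := v *m _ *m _; set vv := v *m _ *m _.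
have addE (M N : 'M[R]_1) : (M + N) 0 0 = M 0 0 + N 0 0 by rewrite mxE.
have scaleE (M : 'M[R]_1) : (t *: M) 0 0 = t * M 0 0 by rewrite mxE.
by rewrite !(addE, scaleE); ring.
Qed.

Lemma qform_shift (R : realType) n (A : 'M[R]_n) (a : R) (u v : 'rV[R]_n) :
  qform (a%:M - A) u v = a * qform 1%:M u v - qform A u v.
Proof.
by rewrite /qform mulmx1 mulmxBr mulmxBl mul_mx_scalar -scalemxAl !mxE.
Qed.

(* The infimum [a] of the upper bounds of the Rayleigh quotient is an eigenvalue:
   if Q = a - A were invertible, Cauchy-Schwarz for the form Q applied to
   u Q^-1 and u would give |u|^2 <= C Q(u), and [a - 1/C] would still be an
   upper bound. *)
Lemma exists_extremal_eigenvalue (R : realType) n (A : 'M[R]_n) :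
  (0 < n)%N -> A^T = A ->
  exists2 a, eigenvalue A a & forall u, qform A u u <= a * qform 1%:M u u.
Proof.
case: n A => // n A _ symA.
pose E := [set a : R | forall u, qform A u u <= a * qform 1%:M u u]%classic.
have lbE u : u != 0 -> lbound E (qform A u u / qform 1%:M u u).
  by move=> u0 a /(_ u); rewrite ler_pdivrMr ?qform1_gt0.
(* Some nonzero vector is needed to bound [E] from below; this is where the dimension must be
   positive. *)
have one_neq0 : const_mx 1 != 0 :> 'rV[R]_n.+1.
  by apply/eqP => /rowP/(_ 0); rewrite !mxE; apply/eqP; exact: oner_neq0.
have infE : has_inf E.
  split; last by eexists; exact: lbE one_neq0.
  by have [C _ hC] := qform_bounded A; exists C.
have EinfE : E (inf E).
  move=> u; have [->|u0] := eqVneq u 0.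
    by rewrite /qform !mul0mx mxE mulr0.
  rewrite -ler_pdivrMr ?qform1_gt0 //.
  by apply: lb_le_inf; [exact: infE.1|exact: lbE].
exists (inf E) => //; set a := inf E in EinfE *.
pose Q := a%:M - A.
have psdQ u : 0 <= qform Q u u by rewrite qform_shift subr_ge0.
have symQ : Q^T = Q by rewrite /Q linearB /= tr_scalar_mx symA.
have [unitQ|] := boolP (Q \in unitmx); last first.
  rewrite -row_free_unit -kermx_eq0 => /rowV0Pn[v /sub_kermxP vQ v0].
  apply/eigenvalueP; exists v => //; apply/esym/eqP.
  by rewrite -mul_mx_scalar -subr_eq0 -mulmxBr vQ.
have [C C0 hC] := qform_bounded (invmx Q).
suff : E (a - C^-1).
  move=> /(ge_inf infE.2); rewrite -/a lerBrDr gerDl.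
  by rewrite leNgt invr_gt0 C0.
move=> u; have [->|u0] := eqVneq u 0.
  by rewrite /qform !mul0mx mxE mulr0.
have N0 := qform1_gt0 u0.
have := qform_Cauchy_Schwarz symQ psdQ (u *m invmx Q) u.
have -> : qform Q (u *m invmx Q) u = qform 1%:M u u.
  by rewrite /qform mulmxKV ?mulmx1.
have -> : qform Q (u *m invmx Q) (u *m invmx Q) = qform (invmx Q) u u.
  by rewrite /qform mulmxKV // trmx_mul trmx_inv symQ mulmxA.
rewrite qform_shift => CS.
set N := qform 1%:M u u in N0 CS *.
have {CS} : N ^+ 2 <= C * N * (a * N - qform A u u).
  apply: le_trans CS (ler_wpM2r _ (hC u)).
  by have := psdQ u; rewrite qform_shift.
(* Dividing by C N leaves A(u) <= (a - 1/C) N. *)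
rewrite expr2 -mulrA mulrCA ler_pM2l // mulrC -ler_pdivrMr //.
by rewrite mulrBl lerBrDr addrC -lerBrDr [C^-1 * _]mulrC.
Qed.


(* Taking absolute values of an extremal vector does not decrease its Rayleigh
   quotient, and extremal vectors of a symmetric form are eigenvectors. *)
Lemma nonneg_symmetric_eigenvector (R : realType) n (A : 'M[R]_n) :
  (0 < n)%N -> A^T = A -> (forall i j, 0 <= A i j) ->
  exists a, exists v : 'rV[R]_n,
    [/\ largest_eigenvalue A a, v *m A = a *: v, v != 0
      & forall i, 0 <= v 0 i].
Proof.
move=> n0 symA posA.
have [a ea leA] := exists_extremal_eigenvalue n0 symA.
have qeig w b : w *m A = b *: w -> qform A w w = b * qform 1%:M w w.
  by move=> wA; rewrite /qform wA mulmx1 -scalemxAl mxE.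
have [w wA w0] := eigenvalueP ea.
pose v : 'rV[R]_n := \row_i `|w 0 i|; exists a, v; split.
- split=> // b /eigenvalueP[u /qeig uA u0].
  by rewrite -(ler_pM2r (qform1_gt0 u0)) -uA.
- have normv : qform 1%:M v v = qform 1%:M w w.
    by rewrite !qform1E; apply: eq_bigr => i _; rewrite mxE real_normK ?num_real.
  pose Q := a%:M - A.
  have psdQ u : 0 <= qform Q u u by rewrite qform_shift subr_ge0.
  have symQ : Q^T = Q by rewrite /Q linearB /= tr_scalar_mx symA.
  have qv : qform Q v v = 0.
    apply/eqP; rewrite eq_le psdQ andbT qform_shift subr_le0 normv -(qeig _ _ wA).
    rewrite !qformE; apply: ler_sum => i _; apply: ler_sum => j _.
    by rewrite !mxE -{2}(ger0_norm (posA i j)) -!normrM ler_norm.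
  apply/esym/eqP; rewrite -mul_mx_scalar -subr_eq0 -mulmxBr.
  apply: contraT => /qform1_gt0; rewrite /qform mulmx1 -/(qform Q v _).
  (* Here Q(v, vQ) is the squared norm of vQ, and Q(v, v) = 0 forces it to vanish. *)
  have := qform_Cauchy_Schwarz symQ psdQ v (v *m Q); rewrite qv mul0r.
  move=> /(conj (sqr_ge0 _))/andP/le_anti/esym/eqP.
  by rewrite sqrf_eq0 => /eqP->; rewrite ltxx.
- apply: contra w0 => /eqP v0; apply/eqP/rowP => i; move/rowP: v0 => /(_ i).
  by rewrite !mxE => /normr0_eq0.
- by move=> i; rewrite mxE.
Qed.

(** * The positive eigenfunction of a connected graph *)

Lemma positive_eigenfunction (R : realType) (T : finType) (e : rel T) :
  symmetric e -> connected_graph e -> (2 <= #|T|)%N ->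
  exists x : T -> R,
    [/\ forall t, 0 < x t, 0 < ind R e
      & forall t, ind R e * x t = \sum_(u | e t u) x u].
Proof.
move=> sym con cardT.
have symA : (adjmx R e)^T = adjmx R e by apply/matrixP => i j; rewrite !mxE sym.
have posA i j : 0 <= adjmx R e i j by rewrite mxE ler0n.
have [a [v [la vA v0 pos]]] :=
  nonneg_symmetric_eigenvector (ltnW cardT) symA posA.
have -> : ind R e = a.
  have lind : largest_eigenvalue (adjmx R e) (ind R e) :=
    xgetI (P := [set a | largest_eigenvalue (adjmx R e) a]%classic) 0 la.
  by apply: le_anti; rewrite (la.2 _ lind.1) (lind.2 _ la.1).
pose x t := v 0 (enum_rank t).
have x0 t : 0 <= x t by exact: pos.
have eigx t : a * x t = \sum_(u | e t u) x u.
  have /rowP/(_ (enum_rank t)) := vA; rewrite !mxE => <-.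
  rewrite (reindex (@enum_rank T)); last exact: onW_bij (enum_rank_bij T).
  rewrite [RHS]big_mkcond; apply: eq_bigr => u _; rewrite !mxE !enum_rankK sym.
  by case: (e t u); rewrite ?mulr1 ?mulr0.
have xpos t : 0 < x t.
  rewrite lt_def x0 andbT; apply: contra v0 => /eqP xt.
  (* At a zero of [x] the nonnegative values at the neighbours sum to 0, so zeros spread along paths
     and, by connectedness, to the whole graph. *)
  have zero c y : path e y c -> x y = 0 -> x (last y c) = 0.
    elim: c y => //= z c IH y /andP[yz hc] xy; apply: IH => //.
    have := eigx y; rewrite xy mulr0 => /esym sum0.
    exact: (psumr_eq0P (fun u _ => x0 u) sum0).
  apply/eqP/rowP => i; rewrite mxE -[i]enum_valK -/(x _).
  by have /connectP[c hc ->] := con t (enum_val i); exact: zero hc xt.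
exists x; split=> //.
(* Two vertices and connectedness give an edge from [y] to some [u], whence a x(y) >= x(u) > 0. *)
have /card_gt1P[y [z [_ _ yz]]] : (1 < #|T|)%N by [].
have [u yu] : exists u, e y u.
  have /connectP[[|u c]] := con y z.
    by move=> _ /esym/eqP; rewrite (negPf yz).
  by move=> /= /andP[yu _] _; exists u.
rewrite -(pmulr_lgt0 _ (xpos y)) eigx (bigD1 u) //=.
by apply: ltr_pwDl => //; exact: sumr_ge0.
Qed.

(** * Trees with a vertex removed *)

(** The vertex [p] stays in the type as an isolated point, which avoids a change of vertex type. *)
Definition del_vertex (T : finType) (e : rel T) (p : T) : rel T :=
  [rel x y | [&& e x y, x != p & y != p]].

(** The empty path is an exception because it is a path even when it starts at [p]. *)
Lemma path_del_vertex (T : finType) (e : rel T) (p x : T) (c : seq T) :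
  path (del_vertex e p) x c = path e x c && ((c == [::]) || (p \notin x :: c)).
Proof.
elim: c x => //= y c IH x; rewrite IH /= !inE !negb_or ![p == _]eq_sym.
case: c {IH} => [|z c] /=; first by rewrite !andbT.
rewrite /del_vertex /= inE negb_or [p == _]eq_sym.
by case: (e x y); case: (x == p); case: (y == p); case: (e y z);
   case: (path e z c); rewrite /= ?andbF.
Qed.

Lemma connect_del_vertexP (T : finType) (e : rel T) (p x y : T) : x != p ->
  reflect (exists c, [/\ path e x c, y = last x c, uniq (x :: c)
                       & p \notin x :: c])
    (connect (del_vertex e p) x y).
Proof.
move=> xp; apply: (iffP connectP) => -[c].
  move=> hc ->; case/shortenP: hc => c' hc' uc' _; exists c'; split=> //.
    by move: hc'; rewrite path_del_vertex => /andP[].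
  move: hc'; rewrite path_del_vertex => /andP[_ /predU1P[->|//]].
  by rewrite inE eq_sym.
by case=> hc -> _ pc; exists c => //; rewrite path_del_vertex hc pc orbT.
Qed.

Lemma connect_del_vertex_sym (T : finType) (e : rel T) (p : T) :
  symmetric e -> connect_sym (del_vertex e p).
Proof.
move=> sym; apply: sym_connect_sym => x y /=.
by rewrite /del_vertex /= sym [(x != p) && _]andbC.
Qed.

(* Otherwise [p] closes a cycle with a simple path from [a] to [b] avoiding it. *)
Lemma acyclic_neighbour_inj (T : finType) (e : rel T) (p a b : T) :
  tree e -> e p a -> e p b -> connect (del_vertex e p) a b -> a = b.
Proof.
move=> [[sym irr] _ acyc] pa pb.
have ap : a != p by apply: contraL pa => /eqP->; rewrite irr.
move=> /(connect_del_vertexP _ _ ap)[[|z c] [hc bE uc pc]] //.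
rewrite {}bE in pb.
case: (acyc [:: p, a, z & c]) => //.
rewrite /ucycle cons_uniq pc uc andbT.
move: hc pb => /= /andP[az hc] pb.
by rewrite pa az rcons_path hc [e _ p]sym pb.
Qed.

(** The first steps [a] and [b] of the two paths are joined through the common end without meeting
    [x], so they coincide by [acyclic_neighbour_inj]; then induct on the tails. *)
Lemma tree_path_unique (T : finType) (e : rel T) (x : T) (c d : seq T) :
  tree e -> path e x c -> path e x d -> uniq (x :: c) -> uniq (x :: d) ->
  last x c = last x d -> c = d.
Proof.
move=> te; have [[sym _] _ _] := te.
elim: c x d => [|a c IH] x [|b d] //.
- move=> _ _ _ /= /andP[/negP xd _] h; case: xd.
  by rewrite [X in X \in _]h mem_last.
- move=> _ _ /= /andP[/negP xd _] _ h; case: xd.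
  by rewrite -[X in X \in _]h mem_last.
move=> /= /andP[xa hc] /andP[xb hd] /andP[xc uc] /andP[xd ud] lcd.
suff ab : a = b by rewrite -ab in hd ud lcd *; rewrite (IH a d).
apply: (acyclic_neighbour_inj te xa xb).
have toward z w : path e z w -> x \notin z :: w ->
    connect (del_vertex e x) z (last z w).
  move=> hw xw; apply/connectP; exists w => //.
  by rewrite path_del_vertex hw xw orbT.
apply: connect_trans (toward _ _ hc xc) _; rewrite lcd.
by rewrite (connect_del_vertex_sym _ sym) toward.
Qed.

(** A shortest path shortens to a simple one on the same vertices. Conversely, any walk shortens to
    the unique simple path between its ends, which is therefore shortest. *)
Lemma same_branchE (T : finType) (e : rel T) (p x y : T) : tree e -> x != p ->
  same_branch e p x y = connect (del_vertex e p) x y.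
Proof.
move=> te xp; apply/asboolP/(connect_del_vertexP _ _ xp).
  case=> c [hc lc minc] pc.
  move: lc; case/shortenP: hc => c' hc' uc' sub lc'; exists c'; split=> //.
  by move: pc; rewrite !inE !negb_or => /andP[-> /=]; apply/contra/sub.
case=> c [hc -> uc pc]; exists c => //; split=> // d hd.
case/shortenP: hd => d' hd' ud' sub ld.
rewrite (tree_path_unique te hc hd' uc ud') //.
by apply: uniq_leq_size => //; case/andP: ud'.
Qed.

(* For an edge [p -- v] of a tree, the component of [v] once [p] is removed. *)
Definition beyond (T : finType) (e : rel T) (p v : T) : {set T} :=
  [set u | connect (del_vertex e p) v u].

Lemma edge_neq (T : finType) (e : rel T) (x y : T) :
  irreflexive e -> e x y -> y != x.
Proof. by move=> irr; apply: contraL => /eqP->; rewrite irr. Qed.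

Lemma beyond_refl (T : finType) (e : rel T) (p v : T) : v \in beyond e p v.
Proof. by rewrite inE connect0. Qed.

Lemma notin_beyond (T : finType) (e : rel T) (p v : T) :
  v != p -> p \notin beyond e p v.
Proof.
move=> vp; rewrite inE; apply/negP => /(connect_del_vertexP _ _ vp)[c [_ pc _]].
by rewrite {1}pc mem_last.
Qed.

(** Removing the first vertex of a simple path out of [v] leaves one that avoids [v]. This recursion
    drives the induction along a branch. *)
Lemma in_beyondP (T : finType) (e : rel T) (p v u : T) :
  tree e -> e p v ->
  (u \in beyond e p v) <->
  u = v \/ exists2 w, e v w && (w != p) & u \in beyond e v w.
Proof.
move=> te pv; have [[sym irr] _ _] := te; have vp := edge_neq irr pv.
split=> [|[->|[w /andP[vw wp]]]]; last 2 first.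
- exact: beyond_refl.
- have wv := edge_neq irr vw.
  rewrite !inE => /(connect_del_vertexP _ _ wv)[c [hc -> uc vc]].
  apply/connectP; exists (w :: c) => //.
  rewrite path_del_vertex /= vw hc inE eq_sym (negPf vp) /=.
  (* if [p] were on the path then [p] and [w] would be two neighbours of [v]
     connected away from [v] *)
  apply: contraNN wp => pc; apply/eqP.
  have vp' : e v p by rewrite sym.
  apply: (acyclic_neighbour_inj te vw vp').
  apply: (@path_connect _ _ w c) => //.
  by rewrite path_del_vertex hc vc orbT.
rewrite inE => /(connect_del_vertexP _ _ vp)[[|w c] [hc -> uc pc]].
  by left.
right; exists w.
  move: hc pc => /= /andP[-> _].
  by rewrite !inE !negb_or [p == w]eq_sym => /and3P[].
rewrite inE; apply/connectP; exists c => //.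
by move: hc uc => /= /andP[_ hc] /andP[vc _]; rewrite path_del_vertex hc vc orbT.
Qed.

(** * The values of [rho] along a branch *)

(** Induction on the number of vertices beyond the edge: without branching, [v] has at most one
    neighbour [w] besides [p], and the claim for the edge from [v] to [w] is the preceding value of
    [rho]. *)
Lemma rho_beyond (R : realType) (T : finType) (e : rel T) (a : R) (x : T -> R) :
  tree e -> 0 < a -> (forall t, 0 < x t) ->
  (forall t, a * x t = \sum_(u | e t u) x u) ->
  forall p v, e p v -> (forall u, u \in beyond e p v -> ~ branching e u) ->
  rho (a ^+ 2) #|beyond e p v| = (a * x v / x p)%:E.
Proof.
move=> te a0 xpos eigx p v; have [[sym irr] _ _] := te.
have [k] := ubnP #|beyond e p v|; elim: k p v => // k IH p v + pv nobr.
have vp := edge_neq irr pv.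
have {}eigx t : a * x t = \sum_(u in [set u | e t u]) x u.
  by rewrite eigx; apply: eq_bigl => u; rewrite inE.
have xn0 t : x t != 0 by rewrite gt_eqF.
have an0 : a != 0 by rewrite gt_eqF.
have deg : (#|[set u | e v u]| <= 2)%N.
  by rewrite leqNgt; apply/negP; exact: nobr (beyond_refl _ _ _).
have [w /andP[vw wp]|leaf] := pickP [pred w | e v w && (w != p)]; last first.
  have -> : beyond e p v = [set v].
    apply/setP => u; rewrite inE; apply/idP/eqP => [|->]; last exact: beyond_refl.
    by move=> /(in_beyondP _ te pv)[//|[w]]; rewrite [_ && _]leaf.
  have Nv : [set u | e v u] = [set p].
    apply/setP => u; rewrite !inE; apply/idP/eqP => [vu|->]; last by rewrite sym.
    by apply: contraFeq (leaf u) => up /=; rewrite vu up.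
  (* At a leaf a x(v) = x(p), so both sides equal 1. *)
  rewrite cards1 /= eigx Nv big_set1 eq_sym sqrf_eq0 (negPf an0).
  by rewrite subr0 !divff ?sqrf_eq0.
have wv := edge_neq irr vw.
have Nv : [set u | e v u] = [set p; w].
  apply/esym/eqP; rewrite eqEcard cards2 eq_sym wp deg andbT.
  by apply/fintype.subsetP => u; rewrite !inE => /orP[]/eqP-> //; rewrite sym.
have beyondE : beyond e p v = v |: beyond e v w.
  apply/setP => u; rewrite in_setU1; apply/idP/orP.
    move=> /(in_beyondP _ te pv)[->|[z /andP[vz zp] uz]]; first by left.
    have /set2P[zp'|<-] : z \in [set p; w] by rewrite -Nv inE.
      by rewrite zp' eqxx in zp.
    by right.
  move=> h; apply/(in_beyondP _ te pv); case: h => [/eqP|uw]; first by left.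
  by right; exists w; rewrite ?vw.
rewrite beyondE cardsU1 notin_beyond //= add1n ltnS => lek.
rewrite IH //; last by move=> u uw; apply: nobr; rewrite beyondE in_setU1 uw orbT.
have := eigx v; rewrite Nv big_setU1 ?big_set1 ?inE 1?[p == w]eq_sym //= => eigv.
have -> : x w = a * x v - x p by rewrite eigv addrAC subrr add0r.
(* This is the denominator in the recurrence; being nonzero, it keeps [rho] away from the infinite
   value. *)
have ne : a ^+ 2 - a * (a * x v - x p) / x v = a * x p / x v.
  by field.
have -> : (a * (a * x v - x p) / x v == a ^+ 2) = false.
  by apply/negbTE; rewrite eq_sym -subr_eq0 ne !mulf_neq0 ?invr_eq0.
rewrite ne; congr (_%:E); by field; rewrite ?xn0 ?an0.
Qed.

(** * Branches and neighbours of the centre *)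

(** The branch of a vertex contains the first vertex after [p] on a simple path from [p] to it. *)
Lemma in_branchesP (T : finType) (e : rel T) (p : T) (A : {set T}) :
  tree e -> (A \in branches e p) <-> exists2 v, e p v & A = beyond e p v.
Proof.
move=> te; have [[sym irr] con _] := te.
have classE v : v != p ->
    [set y in [set~ p] | same_branch e p v y] = beyond e p v.
  move=> vp; apply/setP => y; rewrite !inE same_branchE //.
  by have := notin_beyond e vp; rewrite inE; case: eqVneq => //= -> /negPf->.
split=> [/imsetP[x]|[v pv ->]]; last first.
  have vp := edge_neq irr pv.
  by apply/imsetP; exists v; rewrite ?inE // classE.
rewrite !inE => xp ->; rewrite (classE x) //.
have /connectP[c hc] := con p x.
case/shortenP: hc => -[|v d] hd ud _ lx; first by rewrite lx eqxx in xp.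
move: hd ud => /= /andP[pv hd] /andP[pd _]; exists v => //.
have vx : connect (del_vertex e p) v x.
  by apply/connectP; exists d; rewrite // path_del_vertex hd pd orbT.
apply/setP => y; rewrite !inE.
by rewrite (same_connect (connect_del_vertex_sym p sym) vx).
Qed.

Lemma beyond_inj (T : finType) (e : rel T) (p v w : T) :
  tree e -> e p v -> e p w -> beyond e p v = beyond e p w -> v = w.
Proof.
move=> te pv pw /setP/(_ w); rewrite beyond_refl inE.
exact: acyclic_neighbour_inj.
Qed.

Theorem theorem4p2 (R : realType) (T : finType) (e : rel T)
    (hstar : star_shaped e) (hcard : (2 <= #|T|)%N)
    (g0 : T) (hg0 : center e g0)
    (s : nat) (B : 'I_s -> {set T}) (hB : branch_decomposition e g0 B)
    (n : 'I_s -> nat) (hn : forall i : 'I_s, #|B i| = n i) :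
  rho_tuple (ind R e ^+ 2) n = (ind R e ^+ 2)%:E.
Proof.
have [te _] := hstar; have [[sym irr] con _] := te.
have [x [xpos a0 eigx]] := @positive_eigenfunction R T e sym con hcard.
set a := ind R e in a0 eigx *.
have [injB imB] := hB.
have /fin_all_exists2[v gv Bv] i : exists2 v, e g0 v & B i = beyond e g0 v.
  by apply/(in_branchesP _ _ te); rewrite -imB imset_f.
have rhoE i : rho (a ^+ 2) (n i) = (a * x (v i) / x g0)%:E.
  (* A branching vertex would have to be [g0], which lies outside the branch. *)
  rewrite -hn Bv; apply: rho_beyond => // u gu /hg0 ug.
  by rewrite ug (negPf (notin_beyond e (edge_neq irr (gv i)))) in gu.
rewrite /rho_tuple (eq_bigr _ (fun i _ => rhoE i)) sumEFin; congr (_%:E).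
rewrite -mulr_suml -mulr_sumr.
have injv : injective v by move=> i j vij; apply: injB; rewrite !Bv vij.
(* The map [v] is a bijection from the branch indices to the neighbours of [g0], so this is the
   eigenvalue equation at [g0]. *)
have -> : \sum_i x (v i) = a * x g0.
  rewrite eigx -(big_imset x (in2W injv)) /=; apply: eq_bigl => u.
  apply/imsetP/idP => [[i _ ->]//|gu].
  have : beyond e g0 u \in branches e g0 by apply/(in_branchesP _ _ te); exists u.
  rewrite -imB => /imsetP[i _ eqB]; exists i => //.
  by apply: (beyond_inj te gu (gv i)); rewrite -Bv.
by rewrite mulrA mulfK ?gt_eqF.
Qed.
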